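(* Let $N=2n$ and let $D_N$ be the double chain on $N$ points. Then the number of non-crossing spanning trees of $D_N$ is $O(22.12^N)$.
   Context: A non-crossing spanning tree of a point set $S$ (no three collinear) is a spanning tree on vertex set $S$ drawn with straight-line edges, no two of which intersect except at common endpoints. The double chain on $N=2n$ points consists of two sets of $n$ points each, an upper chain forming a convex chain and a lower chain forming a concave chain, such that every straight line through two points of the upper chain leaves all points of the lower chain on the same side, and vice versa. *)

(* Defs.v *)
From HB Require Import structures.
From mathcomp Require Import all_boot all_order all_algebra.
From mathcomp Require Import all_classical all_reals all_analysis.
From mathcomp Require Import ring lra.

Set Implicit Arguments.
Unset Strict Implicit.
Unset Printing Implicit Defensive.

Import Order.TTheory GRing.Theory Num.Theory.
Import numFieldNormedType.Exports.
Local Open Scope ring_scope.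

Section Graphs.
Variable T : finType.
Implicit Type E : {set {set T}}.

(* A graph on the vertex set T is given by its set of edges, an edge being a
   2-element set of vertices. *)
Definition simple_graph E : Prop := forall e, e \in E -> #|e| = 2%N.

Definition adj E : rel T := [rel x y | (x != y) && ([set x; y]%SET \in E)].

Definition connected_graph E : Prop := forall x y : T, connect (adj E) x y.

(* [ucycle] accepts the two-vertex walk x, y, x; genuine cycles have at least
   three vertices. *)
Definition acyclic_graph E : Prop :=
  forall c : seq T, (2 < size c)%N -> ~ ucycle (adj E) c.

Definition spanning_tree E : Prop :=
  [/\ simple_graph E, connected_graph E & acyclic_graph E].

End Graphs.

Section Plane.
Variable R : realType.
Implicit Types a b c : R * R.

Definition segment a b : set (R * R) :=
  [set r | exists2 t : R, 0 <= t <= 1 &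
     r = ((1 - t) * a.1 + t * b.1, (1 - t) * a.2 + t * b.2)]%classic.

(* Twice the signed area of the triangle a, b, c. When a.1 < b.1, it is positive
   iff c lies strictly above the line ab, and negative iff c lies strictly
   below it. *)
Definition orient a b c : R :=
  (b.1 - a.1) * (c.2 - a.2) - (b.2 - a.2) * (c.1 - a.1).

(* The point set is the image of P, which is injective where this is used. *)
Definition noncrossing (T : finType) (P : T -> R * R) (E : {set {set T}}) :
    Prop :=
  forall x y z t : T,
    [set x; y]%SET \in E -> [set z; t]%SET \in E ->
    [set x; y]%SET != [set z; t]%SET ->
  forall r, segment (P x) (P y) r -> segment (P z) (P t) r ->
  exists v, [/\ v \in [set x; y]%SET, v \in [set z; t]%SET & r = P v].

Definition num_noncrossing_spanning_trees (T : finType) (P : T -> R * R) :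
    nat :=
  #|[set E : {set {set T}} | `[< spanning_tree E /\ noncrossing P E >]]%SET|.

Definition convex_chain n (p : 'I_n -> R * R) : Prop :=
  (forall i j : 'I_n, (i < j)%N -> (p i).1 < (p j).1) /\
  (forall i j k : 'I_n, (i < j < k)%N -> 0 < orient (p i) (p j) (p k)).

Definition concave_chain n (p : 'I_n -> R * R) : Prop :=
  (forall i j : 'I_n, (i < j)%N -> (p i).1 < (p j).1) /\
  (forall i j k : 'I_n, (i < j < k)%N -> orient (p i) (p j) (p k) < 0).

(* [inl] indexes the upper chain and [inr] the lower one, each from left to
   right. Every line through two points of a chain leaves the other chain on one
   side, namely the side announced by the words "upper" and "lower"; the two
   chains thus bulge towards each other. These conditions determine the
   orientation of every triple of points, and they imply that no three points
   are collinear. Injectivity of D has to be required only because it does not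
   follow from the other conditions when n = 1. *)
Definition double_chain n (D : 'I_n + 'I_n -> R * R) : Prop :=
  [/\ injective D,
      convex_chain (fun i => D (inl i)),
      concave_chain (fun i => D (inr i)),
      forall i j k : 'I_n, (i < j)%N ->
        orient (D (inl i)) (D (inl j)) (D (inr k)) < 0 &
      forall i j k : 'I_n, (i < j)%N ->
        0 < orient (D (inr i)) (D (inr j)) (D (inl k))].

Lemma double_chain_exists n : exists D : 'I_n + 'I_n -> R * R, double_chain D.
Proof.
pose h (i : 'I_n) : R := i%:R ^+ 2 + n%:R ^+ 2.
exists (fun u : 'I_n + 'I_n => match u with
  | inl i => (i%:R, h i) | inr i => (i%:R, - h i) end).
have ltR (i j : 'I_n) : (i < j)%N -> i%:R < j%:R :> R by rewrite ltr_nat.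
have bnd (i : 'I_n) : 0 <= (i%:R : R) < n%:R by rewrite ler0n ltr_nat ltn_ord.
have h_gt0 i : 0 < h i by have /andP[? ?] := bnd i; rewrite /h; nra.
have key (i j k : 'I_n) : (i < j)%N ->
    0 < (j%:R - i%:R) * (h k + h i) + (h j - h i) * (k%:R - i%:R).
  move=> /ltR ij; have -> : (j%:R - i%:R) * (h k + h i)
      + (h j - h i) * (k%:R - i%:R)
    = (j%:R - i%:R) * (k%:R ^+ 2 + (i%:R + j%:R) * k%:R
        + (n%:R ^+ 2 - i%:R * j%:R) + n%:R ^+ 2) by rewrite /h; ring.
  have /andP[i0 iN] := bnd i; have /andP[j0 jN] := bnd j.
  have /andP[k0 kN] := bnd k.
  apply: mulr_gt0; first by rewrite subr_gt0.
  have : i%:R * j%:R <= n%:R ^+ 2 :> R by rewrite expr2 ler_pM// ltW.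
  have : 0 <= (i%:R + j%:R) * k%:R :> R by rewrite mulr_ge0 ?addr_ge0.
  have : 0 <= k%:R ^+ 2 :> R by exact: sqr_ge0.
  have : 0 < n%:R ^+ 2 :> R by rewrite exprn_gt0// (le_lt_trans i0).
  lra.
have conv (i j k : 'I_n) : (i < j < k)%N ->
    0 < (j%:R - i%:R) * (h k - h i) - (h j - h i) * (k%:R - i%:R).
  case/andP=> ij jk; have -> : (j%:R - i%:R) * (h k - h i)
      - (h j - h i) * (k%:R - i%:R)
    = (j%:R - i%:R) * (k%:R - i%:R) * (k%:R - j%:R) by rewrite /h; ring.
  by rewrite !mulr_gt0 ?subr_gt0 ?ltR// (ltn_trans ij).
split.
- move=> [i|i] [j|j] [] /eqP; rewrite eqr_nat => /eqP ij hij.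
  + by congr inl; apply: val_inj.
  + by exfalso; have := h_gt0 i; have := h_gt0 j; lra.
  + by exfalso; have := h_gt0 i; have := h_gt0 j; lra.
  + by congr inr; apply: val_inj.
- by split=> [i j /ltR//|i j k /conv].
- by split=> [i j /ltR//|i j k /conv]; rewrite /orient /=; lra.
- by move=> i j k /(key _ _ k); rewrite /orient /=; lra.
- by move=> i j k /(key _ _ k); rewrite /orient /=; lra.
Qed.

End Plane.

(* Main.v *)
Require Import Defs.
From mathcomp Require Import all_boot all_order all_algebra.
From mathcomp Require Import all_classical all_reals all_analysis.
From mathcomp Require Import ring lra zify.

(* Delete the edges between the two chains of a non-crossing spanning tree: what
   remains is a non-crossing forest on each chain, and the deleted edges, being
   pairwise non-crossing, form a chain in the product order of [n] x [n]. As the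
   tree has at most 2n edges, giving every edge the weight 1/3 bounds the number
   of trees by 9^n F^2 B, where F and B are the total weights of the non-crossing
   forests on n points in convex position and of the chains in [n] x [n]. Scanning
   the grid row by row gives B <= 4^n. A forest is cut after the last point joined
   to the first one, and a forest joining its two end points is cut at the last
   neighbour of the first point; the resulting algebraic system for the
   generating functions gives F <= (3114/845)^n. In total the number of trees is
   at most (6 * 3114/845)^(2n), and 6 * 3114/845 < 22.112. The weight 1/3
   nearly minimises this bound. *)

Set Implicit Arguments.
Unset Strict Implicit.
Unset Printing Implicit Defensive.

Import Order.TTheory GRing.Theory Num.Theory.
Import numFieldNormedType.Exports.
Local Open Scope classical_set_scope.
Local Open Scope ring_scope.

(** * Weighted counting of families of sets *)

(** The fibres of [h] are disjoint, so witnesses for distinct [i] are distinct and the other terms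
    only help. Typically [h] reassembles an object from its pieces; it is then enough that every
    object has some decomposition. *)
Lemma ler_sum_cover (R : numDomainType) (I J : finType) (P : pred I)
    (Q : pred J) (h : J -> I) (f : I -> R) (g : J -> R) :
    (forall j, Q j -> 0 <= g j) ->
    (forall i, P i -> exists j, [/\ Q j, h j = i & f i <= g j]) ->
  \sum_(i | P i) f i <= \sum_(j | Q j) g j.
Proof.
move=> g_ge0 cover; rewrite [leRHS](partition_big h predT)//=.
rewrite [leRHS](bigID P)/= -[leLHS]addr0 lerD//; last first.
  by apply: sumr_ge0 => i _; apply: sumr_ge0 => j /andP[/g_ge0].
apply: ler_sum => i /cover[j [Qj hj /le_trans]]; apply.
rewrite (bigD1 j) ?Qj ?hj ?eqxx//= lerDl.
by apply: sumr_ge0 => l /andP[/andP[/g_ge0]].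
Qed.

Section WeightedSum.
Variables (R : numDomainType) (T : finType) (w : R).
Hypothesis w_ge0 : 0 <= w.
Implicit Types (P Q : {set T} -> Prop) (S : {set T}).

Definition wsum P : R := \sum_(S : {set T} | `[< P S >]) w ^+ #|S|.

Lemma wsum_ge0 P : 0 <= wsum P.
Proof. by apply: sumr_ge0 => S _; rewrite exprn_ge0. Qed.

Lemma wsum_le P Q : (forall S, P S -> Q S) -> wsum P <= wsum Q.
Proof.
move=> PQ; apply: (@ler_sum_cover _ _ _ _ _ id) => [S _|S /asboolP PS].
  by rewrite exprn_ge0.
by exists S; split=> //; apply/asboolP/PQ.
Qed.

Lemma wsum_split P Q1 Q2 : (forall S, P S -> Q1 S \/ Q2 S) ->
  wsum P <= wsum Q1 + wsum Q2.
Proof.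
move=> PQ; have -> : wsum Q1 + wsum Q2 =
    \sum_(u : bool * {set T} | `[< if u.1 then Q1 u.2 else Q2 u.2 >])
      w ^+ #|u.2|.
  by rewrite -(pair_big_dep predT (fun b S => `[< if b then Q1 S else Q2 S >])
    (fun _ S => w ^+ #|S|))/= big_bool.
apply: (@ler_sum_cover _ _ _ _ _ snd) => [S _|S /asboolP /PQ PS].
  by rewrite exprn_ge0.
by case: PS => QS; [exists (true, S)|exists (false, S)]; split=> //; apply/asboolP.
Qed.

Lemma wsum_empty P : (forall S, P S -> S = finset.set0) -> wsum P <= 1.
Proof.
move=> P0; have -> : 1 = \sum_(S : {set T} | S == finset.set0) 1 :> R.
  by rewrite big_pred1_eq.
apply: (@ler_sum_cover _ _ _ _ _ id) => // S /asboolP/P0 ->.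
by exists finset.set0; rewrite cards0 expr0.
Qed.

(** A Cauchy product indexed by the cut position [c]; [d] counts the elements that lie in neither
    part and are restored by [h]. *)
Lemma wsum_conv k d P (Q1 Q2 : nat -> {set T} -> Prop)
    (h : nat -> {set T} -> {set T} -> {set T}) :
    (forall S, P S -> exists c S1 S2, [/\ (c < k)%N, Q1 c S1, Q2 c S2,
       h c S1 S2 = S & #|S| = (d + (#|S1| + #|S2|))%N]) ->
  wsum P <= w ^+ d * \sum_(c < k) wsum (Q1 c) * wsum (Q2 c).
Proof.
move=> dec; have -> : w ^+ d * \sum_(c < k) wsum (Q1 c) * wsum (Q2 c) =
    \sum_(u : 'I_k * ({set T} * {set T}) |
        `[< Q1 u.1 u.2.1 >] && `[< Q2 u.1 u.2.2 >])
      w ^+ d * (w ^+ #|u.2.1| * w ^+ #|u.2.2|).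
  rewrite -(pair_big_dep predT
    (fun (c : 'I_k) (v : {set T} * {set T}) => `[< Q1 c v.1 >] && `[< Q2 c v.2 >])
    (fun _ v => w ^+ d * (w ^+ #|v.1| * w ^+ #|v.2|)))/=.
  rewrite mulr_sumr; apply: eq_bigr => c _.
  by rewrite big_distrlr/= pair_big/= mulr_sumr.
apply: (@ler_sum_cover _ _ _ _ _
    (fun u : 'I_k * ({set T} * {set T}) => h u.1 u.2.1 u.2.2)) => [u _|S].
  by rewrite !mulr_ge0// exprn_ge0.
case/asboolP/dec => c [S1 [S2 [ck Q1c Q2c hS cardS]]].
exists (Ordinal ck, (S1, S2)); split=> //=; first by apply/andP; split; apply/asboolP.
by rewrite cardS !exprD.
Qed.

Lemma wsum_setU1 P Q e : (forall S, P S -> e \in S /\ Q (S :\ e)%SET) ->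
  wsum P <= w * wsum Q.
Proof.
move=> PQ; rewrite mulr_sumr.
apply: (@ler_sum_cover _ _ _ _ _ (fun S => e |: S)%SET) => [S _|S].
  by rewrite mulr_ge0// exprn_ge0.
case/asboolP/PQ => eS QS; exists (S :\ e)%SET.
by split; [exact/asboolP|rewrite finset.setD1K|rewrite (cardsD1 e S) eS exprS].
Qed.

End WeightedSum.

(** * Reachability, and cutting non-crossing forests on points in convex position *)

Lemma connect_ind (T : finType) (e : rel T) (X : T -> Prop) a b :
  (forall x y, e x y -> X x -> X y) -> X a -> connect e a b -> X b.
Proof.
move=> eX Xa /connectP[p]; elim: p a Xa => [|y p IH] a Xa /=; first by move=> _ ->.
by move=> /andP[/eX/(_ Xa)]; exact: IH.
Qed.

Section Forests.
Local Open Scope nat_scope.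
Variable M : nat.
Implicit Types (S : {set 'I_M * 'I_M}) (x y : 'I_M).

Definition pedge S : rel 'I_M := [rel x y | ((x, y) \in S) || ((y, x) \in S)].

(** In convex position two edges cross exactly when their end points interleave, so only the order
    of the points is kept. Acyclicity is expressed by every edge being a bridge. *)
Definition ncforest i j S : Prop :=
  [/\ j <= M,
      forall x y, (x, y) \in S -> [&& i <= x, x < y & y < j],
      forall a b c d, (a, b) \in S -> (c, d) \in S -> ~~ [&& a < c, c < b & b < d]
    & forall x y, (x, y) \in S -> ~~ connect (pedge (S :\ (x, y))) x y].

Definition joined S i j : Prop :=
  exists x y, [/\ x = i :> nat, y = j :> nat & connect (pedge S) x y].

Definition restr i j S : {set 'I_M * 'I_M} :=
  [set e in S | (i <= e.1) && (e.2 < j)]%SET.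

Lemma connect_pedge_sub S S' x y : S \subset S' ->
  connect (pedge S) x y -> connect (pedge S') x y.
Proof.
move=> /fintype.subsetP SS'; apply: connect_sub => u v /orP[] /SS' uv.
  by apply: connect1; rewrite /pedge/= uv.
by apply: connect1; rewrite /pedge/= uv orbT.
Qed.

Lemma ncforest_sub i j i' j' S S' : S' \subset S -> j' <= M ->
    (forall x y, (x, y) \in S' -> (i' <= x) && (y < j')) ->
  ncforest i j S -> ncforest i' j' S'.
Proof.
move=> S'S j'M bnd [jM inS ncS foS]; have /fintype.subsetP sub := S'S.
split=> // [x y xy|a b c d /sub ab /sub cd|x y xy].
- by case/and3P: (inS _ _ (sub _ xy)) => _ -> _; rewrite bnd.
- exact: ncS ab cd.
- apply: contra (foS _ _ (sub _ xy)); apply: connect_pedge_sub.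
  exact: finset.setSD.
Qed.

Lemma restr_sub i j S : restr i j S \subset S.
Proof. by apply/fintype.subsetP => e; rewrite inE => /andP[]. Qed.

Lemma ncforest_restr i j i' j' S : j' <= M ->
  ncforest i j S -> ncforest i' j' (restr i' j' S).
Proof.
move=> j'M; apply: ncforest_sub => // [|x y]; first exact: restr_sub.
by rewrite inE => /andP[].
Qed.

Lemma ncforest_pedge i j S x y : ncforest i j S -> pedge S x y ->
  [/\ i <= x, i <= y, x < j, y < j
    & x < y /\ (x, y) \in S \/ y < x /\ (y, x) \in S].
Proof.
by move=> [_ inS _ _] /orP[] xy; case/and3P: (inS _ _ xy) => *; split; try lia;
  [left|right].
Qed.

(** The cut is after the largest vertex [m] in the component of [i]. An edge [(p, q)] with
    [p <= m < q] has [p] outside this component, so a path from [i] to [m] would have to jump over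
    [p] and cross that edge. *)
Lemma ncforest_split i k S : ncforest i (i + k).+1 S ->
  exists c, [/\ c <= k, joined S i (i + c),
    joined (restr i (i + c).+1 S) i (i + c) &
    S = restr i (i + c).+1 S :|: restr (i + c).+1 (i + k).+1 S].
Proof.
move=> fS; have [jM inS ncS _] := fS.
have iM : i < M by lia.
pose x0 := Ordinal iM.
have [m x0m m_max] := @arg_maxnP _ x0 [pred y | connect (pedge S) x0 y] val
  (connect0 _ x0).
have im : i <= m by exact: (m_max x0 (connect0 _ x0)).
have mk : i <= m < (i + k).+1.
  apply: (connect_ind (X := fun y => i <= y < (i + k).+1)) x0m => [x y /(ncforest_pedge fS)[]|/=]; lia.
have Em : i + (m - i) = m by lia.
exists (m - i); rewrite Em; split; first lia.
- by exists x0, m.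
- exists x0, m; split=> //; move: x0m => /=.
  apply: (connect_ind (X := connect (pedge (restr i m.+1 S)) x0)) => //.
  move=> x y xy x0x.
  have x0x' := connect_pedge_sub (restr_sub _ _ _) x0x.
  have x0y' := connect_trans x0x' (connect1 xy).
  have xm : x <= m := m_max _ x0x'; have ym : y <= m := m_max _ x0y'.
  apply: connect_trans x0x _; apply: connect1.
  have [ix iy _ _ _] := ncforest_pedge fS xy.
  by move: xy; rewrite /pedge /= !inE/= ix iy !ltnS xm ym !andbT.
apply/finset.setP => -[p q]; rewrite !inE/=; case pqS: (_ \in S) => //=.
have /and3P[ip pq ->] := inS _ _ pqS.
rewrite ip andbT/=; apply/esym; rewrite -[_ || _]negbK; apply/negP.
rewrite negb_or -!leqNgt => /andP[mq pm].
have x0Np : ~~ connect (pedge S) x0 p.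
  apply/negP => x0p; have /m_max : connect (pedge S) x0 q.
    by apply: connect_trans x0p (connect1 _); rewrite /pedge/= pqS.
  by move=> /= ?; lia.
suff [_] : connect (pedge S) x0 m /\ m < p by lia.
move: (x0m) => /=.
apply: (connect_ind (X := fun x => connect (pedge S) x0 x /\ x < p)) => [x y xy [x0x xp]|]; last first.
  split; first exact: connect0.
  rewrite ltn_neqAle ip andbT; apply: contra x0Np => /eqP Eip.
  by have -> : p = x0 by exact: val_inj.
have x0y := connect_trans x0x (connect1 xy); split=> //.
have ym : y <= m := m_max _ x0y.
have yp : val y != p by apply: contra x0Np => /eqP/val_inj <-.
rewrite ltn_neqAle yp/= leqNgt; apply/negP => py.
have [_ _ _ _ [[_ xyS]|[]]] := ncforest_pedge fS xy; last lia.
by have := ncS _ _ _ _ xyS pqS; lia.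
Qed.

(** The cut is at the last neighbour [y] of the first point: an edge passing over [y] would cross
    [(x, y)] or contradict the choice of [y]. Both blocks contain [y]. Without [(x, y)] the left
    block cannot join its ends, as this would close a cycle. *)
Lemma joined_split i k S : ncforest i (i + k.+1).+1 S -> joined S i (i + k.+1) ->
  exists a (x y : 'I_M), [/\ a <= k, x = i :> nat, y = (i + a).+1 :> nat &
    [/\ (x, y) \in restr i (i + a).+2 S,
      ~ joined (restr i (i + a).+2 S :\ (x, y)) i (i + a).+1,
      joined (restr (i + a).+1 (i + k.+1).+1 S) (i + a).+1 (i + k.+1) &
      S = restr i (i + a).+2 S :|: restr (i + a).+1 (i + k.+1).+1 S]].
Proof.
move=> fS [x0 [z [x0i zk x0z]]]; have [jM inS ncS foS] := fS.
have [y0 x0y0] : exists y0, (x0, y0) \in S.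
  apply: contrapT => noy; suff : z = x0 by move=> Ez; rewrite Ez x0i in zk; lia.
  apply: (connect_ind (X := fun y => y = x0)) x0z => // x y + Ex.
  rewrite {}Ex => /(ncforest_pedge fS).
  by case=> _ iy _ _ [[_ ?]|[]]; [case: noy; exists y|lia].
have [y x0y y_max] := @arg_maxnP _ y0 [pred y | (x0, y) \in S] val x0y0.
rewrite /= in x0y; have /and3P[_ x0ly yk] := inS _ _ x0y.
have Ey : (i + (y - i).-1).+1 = y by lia.
have cover : forall p q, (p, q) \in S -> (q <= y) || (y <= p).
  move=> p q pqS; rewrite -[_ || _]negbK negb_or -!ltnNge; apply/negP.
  move=> /andP[yq py]; have /and3P[ip _ _] := inS _ _ pqS.
  have [px0|/eqP] := eqVneq (val p) x0.
    by have := y_max q; rewrite /= -(val_inj px0) => /(_ pqS)/=; lia.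
  by move: ip => + /= pNx0; have := ncS _ _ _ _ x0y pqS; move: x0i => /=; lia.
exists (y - i).-1, x0, y; rewrite Ey; split=> //; first lia; split.
- by rewrite inE x0y/= ltnS leqnn x0i leqnn.
- move=> [x' [y' [x'i /val_inj -> ]]].
  have -> : x' = x0 by apply: val_inj; rewrite /= x0i.
  move=> cxy; have /negP := foS _ _ x0y; apply.
  by apply: connect_pedge_sub cxy; apply/finset.setSD/restr_sub.
- exists y, z; split=> //.
  suff [|//] : z <= y \/ connect (pedge (restr y (i + k.+1).+1 S)) y z.
    move=> zy; have -> : z = y by apply: val_inj => /=; lia.
    exact: connect0.
  (* No edge passes over [y], so a path can enter the right block only through [y]; what it does to
     the left of [y] is forgotten. *)
  apply: (connect_ind (X := fun z : 'I_M =>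
    z <= y \/ connect (pedge (restr y (i + k.+1).+1 S)) y z)) x0z; last by left; lia.
  move=> u v uv Xu; have [vy|yv] := leqP v y; [by left|right].
  have yu : y <= u.
    by have [_ _ _ _ [] [uv' /cover/orP]] := ncforest_pedge fS uv; lia.
  have uv' : pedge (restr y (i + k.+1).+1 S) u v.
    have [_ _ uk vk _] := ncforest_pedge fS uv.
    by move: uv; rewrite /pedge/= !inE/= uk vk yu (ltnW yv) !andbT.
  case: Xu => [uy|yu']; last exact: connect_trans yu' (connect1 uv').
  have Eu : u = y by apply: val_inj => /=; lia.
  by rewrite Eu in uv'; exact: connect1.
apply/finset.setP => -[p q]; rewrite !inE/=; case pqS: (_ \in S) => //=.
by have /and3P[-> _ ->] := inS _ _ pqS; rewrite ltnS andbT/= cover.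
Qed.

End Forests.


(** The two blocks may share one point, when [j = k.+1], but an edge needs two. *)
Lemma cards_restrU M i j k l (S : {set 'I_M * 'I_M}) :
    (forall x y, (x, y) \in S -> (x < y)%N) -> (j <= k.+1)%N ->
  #|restr i j S :|: restr k l S|%SET = (#|restr i j S| + #|restr k l S|)%N.
Proof.
move=> ltS jk; rewrite cardsU.
suff -> : (restr i j S :&: restr k l S)%SET = finset.set0 by rewrite cards0 subn0.
apply/finset.setP => -[x y]; rewrite !inE/=.
by apply/negP => /andP[/andP[/ltS + /andP[_ +]] /andP[_ /andP[+ _]]]; lia.
Qed.

(** * Recurrences for the forest weights and bounds on their generating functions *)

Section ForestRecurrences.
Variables (R : numDomainType) (w : R) (M : nat).
Hypothesis w_ge0 : 0 <= w.

Definition wforest i k := wsum w (@ncforest M i (i + k).+1).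

Definition wforest_joined i k :=
  wsum w (fun S => @ncforest M i (i + k).+1 S /\ joined S i (i + k)).

(** The index is shifted by one, since a block whose ends are not joined has at least two points.
    With this shift [conv] describes both the cut between two points and the cut at a shared
    point. *)
Definition wforest_split i k :=
  wsum w (fun S => @ncforest M i (i + k).+2 S /\ ~ joined S i (i + k).+1).

Definition conv (A B : nat -> nat -> R) i k : R :=
  \sum_(c < k.+1) A i c * B (i + c).+1 (k - c)%N.

Lemma wforestS i k :
  wforest i k.+1 <= wforest_joined i k.+1 + wforest_split i k.
Proof.
apply: wsum_split => // S; rewrite /wforest_split addnS => fS.
by have [J|NJ] := pselect (joined S i (i + k).+1); [left|right].
Qed.

Lemma wforest0 i : wforest i 0 <= wforest_joined i 0.
Proof.
apply: wsum_le => // S; rewrite addn0 => fS; split=> //.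
have iM : (i < M)%N by have [] := fS.
by exists (Ordinal iM), (Ordinal iM); split=> //; exact: connect0.
Qed.

Lemma wforest_joined0 i : wforest_joined i 0 <= 1.
Proof.
apply: wsum_empty => // S [[_ inS _ _] _]; apply/finset.setP => -[x y].
by rewrite inE; apply/negP => /inS; lia.
Qed.

Lemma wforest_split_conv i k :
  wforest_split i k <= conv wforest_joined wforest i k.
Proof.
rewrite -[leRHS]mul1r -(expr0 w).
apply: (wsum_conv w_ge0 (h := fun _ S1 S2 => (S1 :|: S2)%SET)
  (Q1 := fun c S => @ncforest M i (i + c).+1 S /\ joined S i (i + c))
  (Q2 := fun c => @ncforest M (i + c).+1 ((i + c).+1 + (k - c)).+1)).
move=> S; rewrite -addnS => -[fS NJ].
have [c [ck Jc JcS ES]] := ncforest_split fS.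
(* If the component of [i] reached the last point, the ends would be joined; hence the second block
   is not empty. *)
have {}ck : (c < k.+1)%N.
  rewrite ltn_neqAle ck andbT; apply/eqP => Ec; apply: NJ.
  by rewrite -Ec.
have [jM inS _ _] := fS.
exists c, (restr i (i + c).+1 S), (restr (i + c).+1 (i + k.+1).+1 S); split=> //.
- by split=> //; apply: ncforest_restr fS; lia.
- by rewrite (_ : (i + c).+1 + (k - c) = i + k.+1)%N; [apply: ncforest_restr fS|]; lia.
- by rewrite add0n {1}ES cards_restrU// => x y /inS/and3P[].
Qed.

Lemma wforest_joinedS i k :
  wforest_joined i k.+1 <= w * conv wforest_split wforest_joined i k.
Proof.
rewrite -[X in X * _](expr1 w).
apply: (wsum_conv w_ge0
  (* The deleted edge is recovered from [i] and [a] alone. *)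
  (h := fun a S1 S2 =>
    ([set e : 'I_M * 'I_M | (e.1 == i :> nat) && (e.2 == (i + a).+1 :> nat)]
     :|: S1 :|: S2)%SET)
  (Q1 := fun a S => @ncforest M i (i + a).+2 S /\ ~ joined S i (i + a).+1)
  (Q2 := fun a S => @ncforest M (i + a).+1 ((i + a).+1 + (k - a)).+1 S /\
                    joined S (i + a).+1 ((i + a).+1 + (k - a)))).
move=> S [fS JS]; have [a [x [y [ak xi ya [xyS NJ J ES]]]]] := joined_split fS JS.
have [jM inS _ _] := fS.
have Ek : ((i + a).+1 + (k - a) = i + k.+1)%N by lia.
exists a, (restr i (i + a).+2 S :\ (x, y))%SET,
  (restr (i + a).+1 (i + k.+1).+1 S); split=> //.
- split=> //; apply: ncforest_sub fS => [||u v]; last by rewrite !inE => /and3P[].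
    exact: fintype.subset_trans (finset.subsetDl _ _) (restr_sub _ _ _).
  lia.
- by rewrite Ek; split=> //; apply: ncforest_restr fS; lia.
- rewrite [RHS]ES; congr (_ :|: _)%SET.
  rewrite -[RHS](finset.setD1K xyS); congr (_ :|: _)%SET.
  apply/finset.setP => -[u v]; rewrite !inE/= -ya -xi xpair_eqE.
  by rewrite -!val_eqE.
- rewrite {1}ES cards_restrU; last 2 first.
  + by move=> u v /inS/and3P[].
  + lia.
  by rewrite (cardsD1 (x, y) (restr _ _ _)) xyS addnA.
Qed.

End ForestRecurrences.

(** A truncated Cauchy product omits only nonnegative terms of the product of the truncated sums.
    The bound on [B] is uniform in its start, which varies with [c]. *)
Lemma conv_sum_le (R : numDomainType) (A B : nat -> nat -> R) (z a b : R) N i :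
    (forall i k, 0 <= A i k) -> (forall i k, 0 <= B i k) -> 0 <= z -> 0 <= b ->
    \sum_(k < N) A i k * z ^+ k <= a ->
    (forall j, \sum_(k < N) B j k * z ^+ k <= b) ->
  \sum_(k < N) conv A B i k * z ^+ k <= a * b.
Proof.
move=> A0 B0 z0 b0 Aa Bb.
have -> : \sum_(k < N) conv A B i k * z ^+ k =
    \sum_(c < N) A i c * z ^+ c *
      \sum_(k < N | (c < k.+1)%N) B (i + c).+1 (k - c)%N * z ^+ (k - c).
  under eq_bigr => k _ do rewrite /conv (big_ord_widen N (fun c =>
    A i c * B (i + c).+1 (k - c)%N))// mulr_suml.
  rewrite (exchange_big_dep predT)//=; apply: eq_bigr => c _.
  rewrite mulr_sumr; apply: eq_bigr => k ck.
  by rewrite -[X in _ * z ^+ X = _](subnKC (_ : c <= k)%N)// exprD; ring.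
apply: (@le_trans _ _ (\sum_(c < N) A i c * z ^+ c * b)); last first.
  by rewrite -mulr_suml ler_wpM2r.
apply: ler_sum => c _; rewrite ler_wpM2l ?mulr_ge0 ?exprn_ge0//.
apply: le_trans (Bb (i + c).+1).
(* The default [l] is taken when [l + c] is out of range; such [l] only contribute surplus
   nonnegative terms. *)
apply: (ler_sum_cover (h := fun l : 'I_N => insubd l (l + c)%N)) => [l _|k ck].
  by rewrite mulr_ge0 ?exprn_ge0.
have lN : (k - c < N)%N by exact: leq_ltn_trans (leq_subr _ _) (ltn_ord k).
exists (Ordinal lN); split=> //; apply: val_inj; rewrite val_insubd/= subnK//.
by rewrite ltn_ord.
Qed.

(* The generating functions of the forests and of the joined forests satisfy
   [C = 1 + w z C^2 F] and [F = C + z C F] with inequalities, so that any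
   supersolution [(c, f)] of this system at [z] dominates their partial sums. *)
Lemma wforest_sum_le (R : numDomainType) (w z c f : R) M N :
    0 <= w -> 0 <= z -> 0 <= c -> 0 <= f ->
    1 + w * z * (c * f * c) <= c -> c + z * (c * f) <= f ->
  forall i, \sum_(k < N) wforest_joined w M i k * z ^+ k <= c /\
            \sum_(k < N) wforest w M i k * z ^+ k <= f.
Proof.
(* The sums of length [N] at all starting points control those of length [N.+1], the joined ones
   first because the bound for all forests uses them. *)
move=> w0 z0 c0 f0 hc hf; elim: N => [|N IH] i; first by rewrite !big_ord0.
have F0 j k : 0 <= wforest w M j k by exact: wsum_ge0.
have C0 j k : 0 <= wforest_joined w M j k by exact: wsum_ge0.
have D0 j k : 0 <= wforest_split w M j k by exact: wsum_ge0.
have Dle j : \sum_(k < N) wforest_split w M j k * z ^+ k <= c * f.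
  apply: le_trans (conv_sum_le C0 F0 z0 f0 (IH j).1 (fun l => (IH l).2)).
  by apply: ler_sum => k _; rewrite ler_wpM2r ?exprn_ge0// wforest_split_conv.
have Cle : \sum_(k < N.+1) wforest_joined w M i k * z ^+ k <= c.
  apply: le_trans hc; rewrite big_ord_recl/= expr0 mulr1.
  apply: lerD; first exact: wforest_joined0.
  apply: (@le_trans _ _ (w * z * \sum_(k < N)
    conv (wforest_split w M) (wforest_joined w M) i k * z ^+ k)).
    rewrite mulr_sumr; apply: ler_sum => k _; rewrite /bump/= add1n exprS.
    rewrite [leRHS](_ : _ = (w * conv (wforest_split w M) (wforest_joined w M) i k)
      * (z * z ^+ k)); last by ring.
    by rewrite ler_wpM2r ?mulr_ge0 ?exprn_ge0// wforest_joinedS.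
  rewrite ler_wpM2l ?mulr_ge0//.
  exact: conv_sum_le (Dle i) (fun l => (IH l).1).
split=> //; apply: le_trans hf.
apply: le_trans (lerD Cle (ler_wpM2l z0 (Dle i))).
rewrite !big_ord_recl/= !expr0 !mulr1 -addrA.
apply: lerD; first exact: wforest0.
rewrite mulr_sumr -big_split/=; apply: ler_sum => k _.
rewrite /bump/= add1n exprS [X in _ <= _ + X]mulrCA -mulrDl.
by rewrite ler_wpM2r ?mulr_ge0 ?exprn_ge0// wforestS.
Qed.


(** * Weighted chains in the grid *)

Section Chains.
Local Open Scope nat_scope.
Variable n : nat.
Implicit Types B : {set 'I_n * 'I_n}.

(** The cell [(a, b)] stands for the edge from the upper point [a] to the lower point [b]; the
    second condition excludes crossings. *)
Definition bchain i j B : Prop :=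
  (forall a b, (a, b) \in B -> (a < i) && (b < j)) /\
  (forall a b c d, (a, b) \in B -> (c, d) \in B -> a < c -> b <= d).

Definition row i B := exists a b, (a, b) \in B /\ a = i :> nat.

Lemma bchain_sub i j i' j' B B' : B' \subset B ->
    (forall a b, (a, b) \in B' -> (a < i') && (b < j')) ->
  bchain i j B -> bchain i' j' B'.
Proof.
move=> /fintype.subsetP sub bnd [_ ncB]; split=> // a b c d /sub ab /sub cd.
exact: ncB ab cd.
Qed.

Variables (R : realFieldType) (w : R).
Hypotheses (w_ge0 : (0 <= w)%R) (w_le : (w <= 3^-1)%R).

Definition wchain i j := wsum w (bchain i j).

Definition wchain_row i j := wsum w (fun B => bchain i.+1 j B /\ row i B).

Lemma wchainS i j : (wchain i.+1 j <= wchain i j + wchain_row i j)%R.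
Proof.
apply: wsum_split => // B chB; have [rB|NrB] := pselect (row i B); first by right.
left; apply: bchain_sub (chB) => // a b abB; have [inB _] := chB.
have := inB _ _ abB; rewrite ltnS leq_eqVlt => /andP[/orP[/eqP ai|->//] _].
by case: NrB; exists a, b.
Qed.

Lemma wchain_rowS i j :
  (wchain_row i j.+1 <= wchain_row i j + w * (wchain i j.+1 + wchain_row i j))%R.
Proof.
(* Outside the grid, either row [i] cannot be occupied or column [j] is empty. *)
have [/andP[iN jN]|Nij] := boolP ((i < n) && (j < n)); last first.
  rewrite -[leLHS]addr0 lerD//; last by rewrite mulr_ge0// addr_ge0// wsum_ge0.
  apply: wsum_le => // B [chB rB]; split=> //; apply: bchain_sub (chB) => // a b abB.
  have [inB _] := chB; have /andP[ai bj] := inB _ _ abB; rewrite ai/=.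
  have [a' [b' [_ ai']]] := rB; have := ltn_ord a'; have := ltn_ord b.
  by move: Nij; lia.
pose e : 'I_n * 'I_n := (Ordinal iN, Ordinal jN).
apply: le_trans (_ : _ <= wchain_row i j +
  wsum w (fun B => e \in B /\ bchain i.+1 j.+1 B))%R _.
  apply: wsum_split => // B [chB rB]; have [eB|NeB] := boolP (e \in B); first by right.
  left; split=> //; apply: bchain_sub (chB) => // a b abB.
  have [inB ncB] := chB; have /andP[ai bj] := inB _ _ abB; rewrite ai/=.
  have [a' [b' [ab'B ai']]] := rB.
  have /andP[_ bj'] := inB _ _ ab'B.
  have bj'' : b' != j :> nat.
    apply: contra NeB => /eqP Eb'.
    have -> : e = (a', b') by congr (_, _); apply: val_inj.
    by [].
  have [Ea|Na] := eqVneq (a : nat) i.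
    have : b != j :> nat; last by lia.
    apply: contra NeB => /eqP Eb.
    by have -> : e = (a, b) by congr (_, _); apply: val_inj.
  by have := ncB _ _ _ _ abB ab'B; lia.
rewrite lerD2l; apply: le_trans (_ : _ <=
  w * wsum w (fun B => bchain i j.+1 B \/ bchain i.+1 j B /\ row i B))%R _.
  apply: (wsum_setU1 w_ge0 (e := e)) => B [eB chB]; split=> //.
  have [inB ncB] := chB.
  have [rB|NrB] := pselect (row i (B :\ e)%SET); [right; split=> //|left].
    apply: bchain_sub (chB); first exact: subsetDl.
    move=> a b; rewrite !inE => /andP[abe abB]; have /andP[ai bj] := inB _ _ abB.
    rewrite ai/=; have [Ea|Na] := eqVneq (a : nat) i.
      have : b != j :> nat; last by lia.
      apply: contra abe => /eqP Eb; apply/eqP.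
      by congr (_, _); apply: val_inj.
    have [a' [b' []]] := rB; rewrite !inE => /andP[ab'e ab'B] ai'.
    have /andP[_ bj'] := inB _ _ ab'B.
    have : b' != j :> nat.
      apply: contra ab'e => /eqP Eb'; apply/eqP.
      by congr (_, _); apply: val_inj.
    by have := ncB _ _ _ _ abB ab'B; lia.
  apply: bchain_sub (chB); first exact: subsetDl.
  move=> a b abB; move: (abB); rewrite !inE => /andP[abe /inB/andP[ai bj]].
  rewrite bj andbT ltn_neqAle -ltnS ai andbT; apply/eqP => Ea.
  by apply: NrB; exists a, b.
by rewrite ler_wpM2l// wsum_split.
Qed.

Lemma wchain_le i j : (wchain i j <= 2 ^+ (i + j) /\ wchain_row i j <= 2 ^+ (i + j))%R.
Proof.
have row0 i' : (wchain_row i' 0 <= 0)%R.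
  rewrite /wchain_row /wsum big_pred0// => B.
  apply/asboolP => -[[inB _] [a [b [/inB]]]].
  by rewrite andbF.
have ge1 k : (1 <= 2 ^+ k :> R)%R by rewrite exprn_ege1// ler1n.
(* Here the weight bound enters: [x + (2 * x + x) / 3 = 2 * x], so a new column doubles the bound
   just as a new row does. *)
have rowS i' j' x : (wchain i' j'.+1 <= 2 * x -> wchain_row i' j' <= x ->
    wchain_row i' j'.+1 <= 2 * x)%R.
  move=> hP hQ; apply: le_trans (wchain_rowS _ _) _.
  have : (w * (wchain i' j'.+1 + wchain_row i' j') <=
      3^-1 * (wchain i' j'.+1 + wchain_row i' j'))%R.
    by rewrite ler_wpM2r// addr_ge0// wsum_ge0.
  by move: hP hQ; lra.
elim: i j => [|i IH] j.
  have chain0 j' : (wchain 0 j' <= 2 ^+ (0 + j'))%R.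
    apply: le_trans (ge1 _).
    apply: wsum_empty => // B [inB _]; apply/finset.setP => -[a b].
    by rewrite inE; apply/negP => /inB.
  split=> //; elim: j => [|j IHj]; first by apply: le_trans (row0 _) _; rewrite exprn_ge0.
  by have := chain0 j.+1; rewrite addnS exprS => /rowS; exact.
have chainS j' : (wchain i.+1 j' <= 2 ^+ (i.+1 + j'))%R.
  apply: le_trans (wchainS _ _) _; have [] := IH j'.
  by rewrite addSn exprS; lra.
split=> //; elim: j => [|j IHj].
  by apply: le_trans (row0 _) _; rewrite exprn_ge0.
by have := chainS j.+1; rewrite addnS exprS => /rowS; exact.
Qed.

End Chains.


(** * Bridges and the number of edges of a spanning tree *)

Section Trees.
Variable T : finType.
Implicit Type E : {set {set T}}.

Definition bridged E : Prop := forall x y, x != y -> [set x; y]%SET \in E ->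
  ~~ connect (adj (E :\ [set x; y])%SET) x y.

Lemma adj_sym E : symmetric (adj E).
Proof. by move=> x y; rewrite /adj/= eq_sym finset.setUC. Qed.

(** A path bypassing the edge can be made duplicate-free, and the edge closes it to a cycle. This
    has at least three vertices, since a one-step path would be the removed edge itself. *)
Lemma acyclic_bridged E : acyclic_graph E -> bridged E.
Proof.
move=> acE x y xy xyE; apply/negP => /connectP[p0 /shortenP[p xp up _] Ey].
have subE : subrel (adj (E :\ [set x; y])%SET) (adj E).
  by move=> u v /andP[uv]; rewrite inE => /andP[_ uvE]; apply/andP.
apply: (acE (x :: p)).
  case: p xp Ey {up} => [_ /= Ey|z [|t p]]//=; first by rewrite Ey eqxx in xy.
  by rewrite /adj/= andbT => /andP[_ +] yz; rewrite yz !inE eqxx.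
rewrite /ucycle up andbT /= rcons_path (sub_path subE xp)/= -Ey.
by rewrite /adj/= eq_sym xy finset.setUC.
Qed.

(* Rooting the tree at [r], send an edge to the endpoint which it separates
   from [r]. *)
Lemma card_tree_edges E : spanning_tree E -> (#|E| <= #|T|)%N.
Proof.
move=> [gE cE /acyclic_bridged bE].
have [->|[e0 e0E]] := set_0Vmem E; first by rewrite cards0.
have [r _] : exists r, r \in e0.
  by apply/set0Pn; rewrite -card_gt0 (gE _ e0E).
have child e : e \in E -> exists v,
    v \in e /\ ~~ connect (adj (E :\ e)%SET) r v.
  move=> eE; have /eqP/cards2P[x [y [xy Ee]]] := gE _ eE.
  apply: contrapT => noch; have := bE x y xy; rewrite -Ee => /(_ eE)/negP; apply.
  have csym : connect_sym (adj (E :\ e)%SET) by apply/sym_connect_sym/adj_sym.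
  have rc v : v \in e -> connect (adj (E :\ e)%SET) r v.
    by move=> ve; apply: contrapT => /negP nv; apply: noch; exists v.
  apply: (connect_trans (y := r)); last by apply: rc; rewrite Ee !inE eqxx orbT.
  by rewrite csym; apply: rc; rewrite Ee !inE eqxx.
pose c (e : {set T}) := odflt r [pick v | (v \in e) && ~~ connect (adj (E :\ e)%SET) r v].
have cP e : e \in E -> c e \in e /\ ~~ connect (adj (E :\ e)%SET) r (c e).
  rewrite /c => /child[v [ve nv]]; case: pickP => /= [u /andP[]//|/(_ v)].
  by rewrite ve nv.
suff inj : {in E &, injective c}.
  by rewrite -(card_in_imset inj) max_card.
move=> e f eE fE cef; have [ve nve] := cP e eE; have [vf nvf] := cP f fE.
rewrite -cef in vf nvf; apply/eqP/negP => /negP ef; pose v := c e.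
(* A path from [r] first meets [v] through an edge before which it uses no edge at
   [v]; by the choice of [v] this edge is both [e] and [f]. *)
pose N := [set g in E | v \notin g]%SET.
have sub (g : {set T}) x y : v \in g -> adj N x y -> adj (E :\ g)%SET x y.
  move=> vg /andP[xy]; rewrite !inE => /andP[xyE vxy]; apply/andP; split=> //.
  by rewrite !inE xyE andbT; apply: contra vxy => /eqP Eg; move: vg; rewrite -Eg !inE.
have rv : r != v by apply: contra nve => /eqP ->; exact: connect0.
suff [/eqP //] : v != v /\ connect (adj N) r v.
apply: (connect_ind (X := fun x => x != v /\ connect (adj N) r x)) (cE r v).
  move=> x y /andP[xy xyE] [xv rx].
  have [yv|yv] := eqVneq y v; last first.
    split=> //; apply: connect_trans rx (connect1 _); apply/andP; split=> //.
    by rewrite !inE xyE/= negb_or !(eq_sym v) xv yv.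
  rewrite {}yv in xy xyE.
  have stuck (g : {set T}) : g \in E -> v \in g -> ~~ connect (adj (E :\ g)%SET) r v ->
      [set x; v]%SET = g.
    move=> gE' vg /negP ng; apply/eqP/negP => /negP xvg; apply: ng.
    apply: connect_trans (connect1 (_ : adj (E :\ g)%SET x v)).
      by apply: connect_sub rx => a b /(sub g _ _ vg); exact: connect1.
    by apply/andP; split=> //; rewrite !inE xvg.
  by move: ef; rewrite -(stuck e)// -(stuck f)// eqxx.
by split=> //; exact: connect0.
Qed.

End Trees.


(** * Crossing segments in terms of orientations *)

Section Crossings.
Variable R : realType.
Implicit Types a b c d : R * R.

Lemma orientC a b c : orient a c b = - orient a b c.
Proof. by rewrite /orient; ring. Qed.

Lemma orient_rot a b c : orient b c a = orient a b c.
Proof. by rewrite /orient; ring. Qed.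

(** [orient c d] is affine along [ab], so it vanishes at parameter [x / (x - y)], where [x] and [y]
    are its end values; likewise for [orient a b] along [cd]. The two denominators are opposite, and
    both parameters give the same point. *)
Lemma segments_meet a b c d :
    orient a b c * orient a b d < 0 -> orient c d a * orient c d b < 0 ->
  exists2 r, segment a b r & segment c d r.
Proof.
have ratio (x y : R) : x * y < 0 -> x - y != 0 /\ 0 <= x / (x - y) <= 1.
  move=> xy; have [x0|x0|x0] := ltgtP x 0; last by rewrite x0 mul0r ltxx in xy.
  - have y0 : 0 < y by rewrite -(nmulr_rlt0 _ x0).
    have d0 : x - y < 0 by lra.
    by rewrite ltr0_neq0// ler_ndivlMr// ler_ndivrMr// mul0r mul1r; split=> //; lra.
  - have y0 : y < 0 by rewrite -(pmulr_rlt0 _ x0).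
    have d0 : 0 < x - y by lra.
    by rewrite gt_eqF// ler_pdivlMr// ler_pdivrMr// mul0r mul1r; split=> //; lra.
move=> /ratio[d1 t1] /ratio[d2 t2].
set t := _ / _ in t2; set u := _ / _ in t1.
exists ((1 - t) * a.1 + t * b.1, (1 - t) * a.2 + t * b.2); first by exists t.
have d12 : orient a b c - orient a b d = - (orient c d a - orient c d b).
  by rewrite /orient; ring.
exists u => //; rewrite /u /t d12; move: d2; rewrite /orient => d2.
by congr (_, _); field.
Qed.

Lemma noncrossing_orient (T : finType) (P : T -> R * R) (E : {set {set T}})
    (x y z t : T) : noncrossing P E ->
    [set x; y]%SET \in E -> [set z; t]%SET \in E ->
    x \notin [set z; t]%SET -> y \notin [set z; t]%SET ->
    orient (P x) (P y) (P z) * orient (P x) (P y) (P t) < 0 ->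
    orient (P z) (P t) (P x) * orient (P z) (P t) (P y) < 0 -> False.
Proof.
move=> ncE xyE ztE xzt yzt /segments_meet meet /meet[r r1 r2].
have xy_zt : [set x; y]%SET != [set z; t]%SET.
  by apply: contra xzt => /eqP <-; rewrite !inE eqxx.
have [v [+ vzt _]] := ncE x y z t xyE ztE xy_zt r r1 r2.
by rewrite !inE => /orP[] /eqP Ev; move: vzt; rewrite Ev; exact/negP.
Qed.

End Crossings.

(** * Splitting a tree into two chain forests and a grid chain *)

Section Pieces.
Variables (R : realType) (n : nat).
Local Notation V := ('I_n + 'I_n)%type.
Implicit Types (E : {set {set V}}) (f : 'I_n -> V).

Definition chain_edges f E : {set 'I_n * 'I_n} :=
  [set e : 'I_n * 'I_n | (e.1 < e.2)%N && ([set f e.1; f e.2] \in E)]%SET.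

Definition bridging_edges E : {set 'I_n * 'I_n} :=
  [set e : 'I_n * 'I_n | [set inl e.1; inr e.2] \in E]%SET.

Definition assemble (u : {set 'I_n * 'I_n} * {set 'I_n * 'I_n} * {set 'I_n * 'I_n}) :
    {set {set V}} :=
  ([set [set inl e.1; inl e.2] | e in u.1.1] :|:
   [set [set inr e.1; inr e.2] | e in u.1.2] :|:
   [set [set inl e.1; inr e.2] | e in u.2])%SET.

Definition pieces E := (chain_edges inl E, chain_edges inr E, bridging_edges E).

Lemma piecesK E : simple_graph E -> assemble (pieces E) = E.
Proof.
move=> gE; apply/finset.setP => e; apply/idP/idP => [|eE].
  rewrite !inE => /orP[/orP[]|] /imsetP[[a b]]; rewrite inE/= => + ->//.
    by case/andP.
  by case/andP.
have /eqP/cards2P[x [y [xy Ee]]] := gE _ eE; rewrite {e}Ee in eE *.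
(* The end points are put in the order used by [assemble]: upper before lower, left before right. *)
wlog : x y xy eE / match x, y with
    | inl a, inl b | inr a, inr b => (a < b)%N | inl _, inr _ => true
    | inr _, inl _ => false end.
  move=> wl; case: x y xy eE => [a|a] [b|b] xy eE; last 1 first.
  - have [ab|ba|ab] := ltngtP a b; first exact: wl.
      by rewrite finset.setUC; apply: wl => //; rewrite 1?eq_sym 1?finset.setUC.
    by rewrite (val_inj ab) eqxx in xy.
  - have [ab|ba|ab] := ltngtP a b; first exact: wl.
      by rewrite finset.setUC; apply: wl => //; rewrite 1?eq_sym 1?finset.setUC.
    by rewrite (val_inj ab) eqxx in xy.
  - exact: wl.
  - by rewrite finset.setUC; apply: wl => //; rewrite 1?eq_sym 1?finset.setUC.
case: x y xy eE => [a|a] [b|b] // _ abE ab; rewrite !inE.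
- by apply/orP; left; apply/orP; left; apply/imsetP; exists (a, b); rewrite // inE ab.
- by apply/orP; right; apply/imsetP; exists (a, b); rewrite // inE.
- by apply/orP; left; apply/orP; right; apply/imsetP; exists (a, b); rewrite // inE ab.
Qed.

(** The three kinds of edges are disjoint, and each edge has a single encoding because chain edges
    are stored from left to right. *)
Lemma card_pieces E : simple_graph E ->
  (#|chain_edges inl E| + #|chain_edges inr E| + #|bridging_edges E| <= #|E|)%N.
Proof.
move=> gE; rewrite -[in leqRHS](piecesK gE) /assemble/=.
have injf f : injective f ->
    {in chain_edges f E &, injective (fun e : 'I_n * 'I_n => [set f e.1; f e.2]%SET)}.
  move=> fI [a b] [c d]; rewrite !inE/= => /andP[ab _] /andP[cd _] Eabcd.
  have ain : f a \in [set f c; f d]%SET by rewrite -Eabcd !inE eqxx.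
  have bin : f b \in [set f c; f d]%SET by rewrite -Eabcd !inE eqxx orbT.
  move: ain bin; rewrite !inE !(inj_eq fI).
  move=> /orP[]/eqP Ea /orP[]/eqP Eb; rewrite ?Ea ?Eb// in ab *; lia.
have injb : {in bridging_edges E &, injective
    (fun e : 'I_n * 'I_n => [set inl e.1; inr e.2]%SET : {set V})}.
  move=> [a b] [c d] _ _ /= Eabcd.
  have ain : (inl a : V) \in [set inl c; inr d]%SET by rewrite -Eabcd !inE eqxx.
  have bin : (inr b : V) \in [set inl c; inr d]%SET by rewrite -Eabcd !inE eqxx orbT.
  by move: ain bin; rewrite !inE => /orP[/eqP[->]|//] /orP[//|/eqP[->]].
have inlI : injective (@inl 'I_n 'I_n) by move=> ? ? [].
have inrI : injective (@inr 'I_n 'I_n) by move=> ? ? [].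
rewrite -(card_in_imset (injf _ inlI)) -(card_in_imset (injf _ inrI)).
rewrite -(card_in_imset injb) !cardsU.
pose A : {set {set V}} := [set [set inl e.1; inl e.2] | e in chain_edges inl E]%SET.
pose B : {set {set V}} := [set [set inr e.1; inr e.2] | e in chain_edges inr E]%SET.
pose C : {set {set V}} := [set [set inl e.1; inr e.2] | e in bridging_edges E]%SET.
rewrite -/A -/B -/C.
have -> : (A :&: B = finset.set0)%SET.
  apply/finset.setP => e; rewrite !inE; apply/negP => /andP[/imsetP[u _ ->]].
  move=> /imsetP[v _ Euv]; have : (inl u.1 : V) \in [set inr v.1; inr v.2]%SET.
    by rewrite -Euv !inE eqxx.
  by rewrite !inE.
have -> : ((A :|: B) :&: C = finset.set0)%SET.
  apply/finset.setP => e; rewrite !inE; apply/negP => /andP[eAB /imsetP[u _ Eu]].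
  move: eAB; rewrite {}Eu => /orP[] /imsetP[v _ Euv].
    have : (inr u.2 : V) \in [set inl v.1; inl v.2]%SET.
      by rewrite -Euv !inE eqxx orbT.
    by rewrite !inE.
  have : (inl u.1 : V) \in [set inr v.1; inr v.2]%SET by rewrite -Euv !inE eqxx.
  by rewrite !inE.
by rewrite cards0 !subn0.
Qed.

(** The sign of [c] lets one argument serve the convex and the concave chain. Edges with
    interleaving end points separate each other's ends, and a detour within the chain is a detour in
    the tree. *)
Lemma ncforest_chain (P : V -> R * R) f E (c : R) : injective f ->
    (forall i j k : 'I_n, (i < j < k)%N -> 0 < c * orient (P (f i)) (P (f j)) (P (f k))) ->
    bridged E -> noncrossing P E -> ncforest 0 n (chain_edges f E).
Proof.
move=> fI cP bE ncE; split=> // [x y|i k j l|x y xyS].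
- by rewrite inE /= => /andP[-> _]; rewrite ltn_ord.
- rewrite !inE/= => /andP[ik ikE] /andP[jl jlE]; apply/negP => /and3P[ij jk kl].
  have neg (x y : R) : 0 < c * x -> 0 < c * y -> (- x) * y < 0.
    move=> cx cy; rewrite mulNr oppr_lt0.
    have := mulr_gt0 cx cy; rewrite mulrACA pmulr_rgt0//.
    rewrite lt0r mulf_eq0 orbb -expr2 sqr_ge0 andbT.
    by apply: contraTneq cx => ->; rewrite mul0r ltxx.
  have nin (x y z : 'I_n) : x != y -> x != z -> f x \notin [set f y; f z]%SET.
    by rewrite !inE !(inj_eq fI) negb_or => -> ->.
  apply: (noncrossing_orient ncE ikE jlE).
  + by apply: nin; rewrite -val_eqE/=; lia.
  + by apply: nin; rewrite -val_eqE/=; lia.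
  + by rewrite orientC; apply: neg; apply: cP; lia.
  + by rewrite mulrC orientC [X in _ * X]orient_rot; apply: neg; apply: cP; lia.
move: xyS; rewrite inE/= => /andP[xy xyE].
have fxy : f x != f y by rewrite (inj_eq fI) -val_eqE/= ltn_eqF.
apply: contra (bE _ _ fxy xyE); apply: (connect_ind
  (X := fun z => connect (adj (E :\ [set f x; f y])%SET) (f x) (f z))) => // u v uv fu.
apply: connect_trans fu (connect1 _).
have edge a b : (a, b) \in (chain_edges f E :\ (x, y))%SET ->
    adj (E :\ [set f x; f y])%SET (f a) (f b).
  rewrite !inE xpair_eqE/= => /and3P[abxy ab abE].
  rewrite /adj/= (inj_eq fI) -val_eqE/= ltn_eqF//= !inE abE andbT.
  apply: contra abxy => /eqP Eab.
  have ain : f a \in [set f x; f y]%SET by rewrite -Eab !inE eqxx.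
  have bin : f b \in [set f x; f y]%SET by rewrite -Eab !inE eqxx orbT.
  move: ain bin; rewrite !inE !(inj_eq fI).
  by move=> /orP[]/eqP Ea /orP[]/eqP Eb; rewrite ?Ea ?Eb ?eqxx// in ab *; lia.
by case/orP: uv => /edge//; rewrite adj_sym.
Qed.

(** If [a < c] and [d < b], the edges are the diagonals of a convex quadrilateral with two corners
    on each chain. *)
Lemma bchain_bridging (D : V -> R * R) E : double_chain D -> noncrossing D E ->
  bchain n n (bridging_edges E).
Proof.
move=> [_ _ _ up low] ncE; split=> [a b|a b c d]; first by rewrite !ltn_ord.
rewrite !inE/= => abE cdE ac; rewrite leqNgt; apply/negP => db.
apply: (noncrossing_orient ncE abE cdE).
- by rewrite !inE; apply/negP => /orP[/eqP[Ea]|//]; rewrite Ea ltnn in ac.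
- by rewrite !inE; apply/negP => /orP[//|/eqP[Eb]]; rewrite Eb ltnn in db.
- rewrite (_ : orient _ _ (D (inl c)) = - orient (D (inl a)) (D (inl c)) (D (inr b)));
    last exact: orientC.
  rewrite (_ : orient _ _ (D (inr d)) = - orient (D (inr d)) (D (inr b)) (D (inl a)));
    last by rewrite /orient; ring.
  by rewrite mulrNN nmulr_rlt0 ?up ?low.
- rewrite orient_rot -[orient _ _ (D (inr b))]orient_rot.
  by rewrite nmulr_rlt0 ?up ?low.
Qed.

End Pieces.


(** * Assembling the bound *)

Lemma num_trees_le (R : realType) n (D : 'I_n + 'I_n -> R * R) :
    double_chain D ->
  (num_noncrossing_spanning_trees D)%:R <=
  9 ^+ n * (wsum 3^-1 (@ncforest n 0 n) ^+ 2 * wchain n (3^-1 : R) n n).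
Proof.
move=> dcD; have [_ [_ upD] [_ lowD] _ _] := dcD.
set w : R := 3^-1; have w0 : 0 <= w by rewrite /w; lra.
pose S := {set 'I_n * 'I_n}%type.
have -> : 9 ^+ n * (wsum w (@ncforest n 0 n) ^+ 2 * wchain n w n n) =
    \sum_(u : S * S * S | `[< ncforest 0 n u.1.1 >] && `[< ncforest 0 n u.1.2 >] &&
        `[< bchain n n u.2 >])
      9 ^+ n * (w ^+ #|u.1.1| * w ^+ #|u.1.2| * w ^+ #|u.2|).
  rewrite expr2 [in LHS]/wsum big_distrlr/= pair_big/=.
  by rewrite [X in _ * X = _]big_distrlr/= pair_big/= mulr_sumr.
rewrite /num_noncrossing_spanning_trees -sum1_card natr_sum.
apply: (ler_sum_cover (h := @assemble n)) => [u _|E].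
  by rewrite !mulr_ge0// exprn_ge0.
rewrite inE => /asboolP[tE ncE]; have [gE _ aE] := tE.
have bE := acyclic_bridged aE.
exists (pieces E); split; last 1 first.
(* The tree has at most [2n] edges of weight [1/3], which [9 ^+ n] compensates. *)
- rewrite /= -!exprD (_ : 9 = 3 ^+ 2); last by ring.
  rewrite -exprM exprVn ler_pdivlMr ?mul1r ?exprn_gt0//.
  apply: ler_weXn2l; first by rewrite ler1n.
  apply: leq_trans (card_pieces gE) _; apply: leq_trans (card_tree_edges tE) _.
  by rewrite card_sum card_ord mulSn mul1n.
- apply/andP; split; [apply/andP; split|]; apply/asboolP.
  + apply: (@ncforest_chain _ _ D inl _ 1) => // [? ? []//|i j k ijk].
    by rewrite mul1r; exact: upD.
  + apply: (@ncforest_chain _ _ D inr _ (-1)) => // [? ? []//|i j k ijk].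
    by rewrite mulN1r oppr_gt0; exact: lowD.
  + exact: bchain_bridging dcD ncE.
- exact: piecesK.
Qed.

(** The last term of the partial sum is at most the bound [f], and [f <= z^-1] turns this into a
    pure power whose exponent is the number of points. *)
Lemma wforest_le (R : realType) n :
  wforest (3^-1 : R) n.+1 0 n <= (3114 / 845) ^+ n.+1.
Proof.
have w0 : 0 <= (3^-1 : R) by lra.
have main (z f : R) : 0 < z -> f <= z^-1 ->
    \sum_(k < n.+1) wforest (3^-1 : R) n.+1 0 k * z ^+ k <= f ->
    wforest (3^-1 : R) n.+1 0 n <= z^-1 ^+ n.+1.
  move=> z0 fz; rewrite big_ord_recr/= => zF.
  have {zF} : wforest (3^-1 : R) n.+1 0 n * z ^+ n <= f.
    apply: le_trans zF; rewrite lerDr; apply: sumr_ge0 => k _.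
    by apply: mulr_ge0 (wsum_ge0 w0 _) (exprn_ge0 _ (ltW z0)).
  rewrite -ler_pdivlMr ?exprn_gt0// => /le_trans; apply.
  by rewrite exprS exprVn ler_wpM2r// invr_ge0 exprn_ge0// ltW.
rewrite -[3114 / 845]invf_div.
apply: (main _ (65 / 108 * (3114 / 845))); [lra|rewrite invf_div; lra|].
(* These constants solve the system of [wforest_sum_le] with equality. They come
   from the rational parametrisation of that curve, at a point close to the
   radius of convergence. *)
by have [||||||_] := @wforest_sum_le R 3^-1 (845 / 3114) (65 / 173 * (3114 / 845))
  (65 / 108 * (3114 / 845)) n.+1 n.+1 _ _ _ _ _ _ 0%N; [lra..|].
Qed.

Theorem theorem4 (R : realType) (D : forall n : nat, 'I_n + 'I_n -> R * R)
    (D_double_chain : forall n : nat, double_chain (D n)) :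
  (fun n : nat => (num_noncrossing_spanning_trees (D n))%:R : R)
    =O_\oo (fun n : nat => (2212 / 100 : R) ^+ (2 * n)).
Proof.
have w0 : 0 <= (3^-1 : R) by lra.
(* The constants matter only through [6 * r <= q]: each unit of [n] contributes
   [9 * r ^+ 2 * 2 ^+ 2 = (6 * r) ^+ 2]. *)
suff main (q r : R) : 0 <= q -> 0 <= r -> 6 * r <= q ->
    (forall n, wforest (3^-1 : R) n.+1 0 n <= r ^+ n.+1) ->
    (fun n : nat => (num_noncrossing_spanning_trees (D n))%:R : R)
      =O_\oo (fun n : nat => q ^+ (2 * n)).
  by apply: main (wforest_le R); lra.
move=> q0 r0 rq Fr.
(* The constant [1] works from [n = 1] on; the forest bound is about at least one point. *)
apply/eqO_exP; exists 1 => //; exists 1%N => // -[//|n] _ /=.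
rewrite mul1r !ger0_norm ?ler0n ?exprn_ge0//.
apply: le_trans (num_trees_le (D_double_chain n.+1)) _.
have F0 : 0 <= wforest (3^-1 : R) n.+1 0 n by exact: wsum_ge0.
have P0 : 0 <= wchain n.+1 (3^-1 : R) n.+1 n.+1 by exact: wsum_ge0.
have [P _] := wchain_le n.+1 w0 (lexx _) n.+1 n.+1.
apply: (@le_trans _ _ (9 ^+ n.+1 * (r ^+ n.+1 ^+ 2 * 2 ^+ (n.+1 + n.+1)))).
  rewrite ler_wpM2l ?exprn_ge0//; apply: ler_pM => //; first exact: exprn_ge0.
  by apply: lerXn2r (Fr n); rewrite nnegrE ?exprn_ge0.
apply: (@le_trans _ _ ((6 * r) ^+ (2 * n.+1))).
  rewrite -exprM mulnC addnn -mul2n !exprM -!exprMn.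
  by rewrite (_ : 9 * (r * 2) ^+ 2 = (6 * r) ^+ 2)//; ring.
by apply: lerXn2r rq; rewrite nnegrE ?mulr_ge0.
Qed.
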